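(* Let $\mathbf{D}$ be a subcategory of the category of Noetherian rings satisfying the closure conditions listed in the context, and let $\mathcal{P}$ be a ring-theoretic property defined on the objects of $\mathbf{D}$. Assume: (a) for every $A \in \mathbf{D}$, if $A$ has $\mathcal{P}$, then the polynomial ring $A[X]$ has $\mathcal{P}$; (b) for every local ring $(A,\mathfrak{m})$ in $\mathbf{D}$ and every nonzero divisor $y \in \mathfrak{m}$, if the associated graded ring $G(yA)=\bigoplus_{n \ge 0} y^nA/y^{n+1}A$ has $\mathcal{P}$, then $A$ has $\mathcal{P}$. Then for every local ring $(A,\mathfrak{m})$ in $\mathbf{D}$ and every nonzero divisor $y \in \mathfrak{m}$, if $A/yA$ has $\mathcal{P}$, then $A$ has $\mathcal{P}$.
   Context: All rings are commutative with unit. The subcategory $\mathbf{D}$ of the category of Noetherian rings is assumed to satisfy the following: if $A \in \mathbf{D}$, then (i) every finitely generated $A$-algebra belongs to $\mathbf{D}$; (ii) every localization of $A$ with respect to a multiplicative subset of $A$ belongs to $\mathbf{D}$; (iii) every subring $B \subseteq A$ such that $A$ is faithfully flat over $B$ belongs to $\mathbf{D}$; (iv) for every ideal $I \subseteq A$, the Rees ring $A[It]=\bigoplus_{n\ge 0} I^n t^n \subseteq A[t]$ and the extended Rees ring $A[It,t^{-1}]=\bigoplus_{n\in\mathbb{Z}} I^n t^n \subseteq A[t,t^{-1}]$ (with $I^n=A$ for $n\le 0$) belong to $\mathbf{D}$. A ring-theoretic property is a property of rings in $\mathbf{D}$ invariant under ring isomorphism. For an ideal $I \subseteq A$, the associated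 graded ring is $G(I)=\bigoplus_{n\ge 0} I^n/I^{n+1}$. *)

(* Defs.v *)
From HB Require Import structures.
From mathcomp Require Import all_boot all_order all_algebra.
From mathcomp Require Import boolp.

Set Implicit Arguments.
Unset Strict Implicit.
Unset Printing Implicit Defensive.

Import GRing.Theory.
Local Open Scope ring_scope.
Local Open Scope quotient_scope.

(* Rings are [comPzRingType]s, so the zero ring is a ring.  [boolp] makes every
   subset a boolean predicate, so [{pred A}] ranges over all subsets of A.    *)

Record ideal (A : comPzRingType) := Ideal {
  ideal_pred :> {pred A};
  ideal_closed : submod_closed (ideal_pred : {pred A^o}) }.

Section IdealTheory.
Variables (A : comPzRingType) (I : ideal A).

Lemma ideal_zmod_closed : zmod_closed I.
Proof. exact: GRing.submod_closedB (ideal_closed I). Qed.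

HB.instance Definition _ :=
  GRing.isZmodClosed.Build A (ideal_pred I) ideal_zmod_closed.

Lemma idealMl a x : x \in I -> a * x \in I.
Proof.
have [I0 IP] := ideal_closed I => Ix.
by rewrite -[a * x]addr0; apply: (IP a x 0).
Qed.

Lemma idealMr a x : x \in I -> x * a \in I.
Proof. by rewrite mulrC; apply: idealMl. Qed.

End IdealTheory.

Lemma full_ideal_closed (A : comPzRingType) :
  submod_closed ([pred _ | true] : {pred A^o}).
Proof. by []. Qed.
Definition full_ideal (A : comPzRingType) : ideal A :=
  Ideal (@full_ideal_closed A).

Definition principal_pred (A : comPzRingType) (y : A) : {pred A} :=
  fun x => `[< exists a, x = a * y >].
Lemma principal_closed (A : comPzRingType) (y : A) :
  submod_closed (principal_pred y : {pred A^o}).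
Proof.
split=> [|a u v /asboolP[b ->] /asboolP[c ->]]; apply/asboolP.
  by exists 0; rewrite mul0r.
by exists (a * b + c); rewrite mulrDl -mulrA.
Qed.
Definition principal (A : comPzRingType) (y : A) : ideal A :=
  Ideal (principal_closed y).

Definition ideal_mul_pred (A : comPzRingType) (I J : ideal A) : {pred A} :=
  fun x => `[< exists2 s : seq (A * A),
    (forall p, p \in s -> (p.1 \in I) && (p.2 \in J)) &
    x = \sum_(p <- s) p.1 * p.2 >].
Lemma ideal_mul_closed (A : comPzRingType) (I J : ideal A) :
  submod_closed (ideal_mul_pred I J : {pred A^o}).
Proof.
split=> [|a u v /asboolP[s sP ->] /asboolP[t tP ->]]; apply/asboolP.
  by exists [::] => //; rewrite big_nil.
exists ([seq (a * p.1, p.2) | p <- s] ++ t) => [p|].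
  rewrite mem_cat => /orP[/mapP[q /sP/andP[q1 q2] ->]|/tP //].
  by rewrite /= q2 idealMl.
rewrite big_cat big_map /= /GRing.scale /= big_distrr /=; congr (_ + _).
by apply: eq_bigr => p _; rewrite mulrA.
Qed.
Definition ideal_mul (A : comPzRingType) (I J : ideal A) : ideal A :=
  Ideal (ideal_mul_closed I J).

Definition ideal_pow (A : comPzRingType) (I : ideal A) (n : nat) : ideal A :=
  iter n (ideal_mul I) (full_ideal A).

Section IdealPowers.
Variables (A : comPzRingType) (I : ideal A).
Local Notation "I ^^ n" := (ideal_pow I n) (at level 29).

Lemma ideal_powSP n (P : A -> Prop) :
  (forall a b, a \in I -> b \in I ^^ n -> P (a * b)) -> P 0 ->
  (forall a b, P a -> P b -> P (a + b)) ->
  forall x, x \in I ^^ n.+1 -> P x.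
Proof.
move=> Pmul P0 Padd x /asboolP[s sP ->].
rewrite big_seq; elim/big_ind: _ => // p /sP/andP[p1 p2]; exact: Pmul.
Qed.

Lemma ideal_powM i j x y : x \in I ^^ i -> y \in I ^^ j -> x * y \in I ^^ (i + j).
Proof.
elim: i x => [|i IHi] x xI yI; first exact: idealMl.
elim/ideal_powSP: xI => [a b aI bI||a b abI cbI].
- rewrite -mulrA addSn; apply/asboolP; exists [:: (a, b * y)] => [p|].
    by rewrite inE => /eqP -> /=; rewrite aI IHi.
  by rewrite big_seq1.
- by rewrite mul0r rpred0.
- by rewrite mulrDl rpredD.
Qed.

Lemma ideal_powS n x : x \in I ^^ n.+1 -> x \in I ^^ n.
Proof.
elim/ideal_powSP => [a b aI bI||a b]; first exact: idealMl.
  exact: rpred0.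
exact: rpredD.
Qed.

End IdealPowers.

(* The additive group comes from [Quotient.quot]; its library ring structure
   on it requires I proper and A nonzero.                                     *)
Definition quot_ring (A : comPzRingType) (I : ideal A) := Quotient.quot I.

Section QuotRing.
Variables (A : comPzRingType) (I : ideal A).
Local Notation Q := (quot_ring I).

HB.instance Definition _ := EqQuotient.on Q.
HB.instance Definition _ := GRing.Zmodule.on Q.

Definition quot_pi (x : A) : Q := \pi_Q x.
Definition quot_repr (x : Q) : A := repr x.

Lemma quot_reprK : cancel quot_repr quot_pi.
Proof. exact: reprK. Qed.

Lemma quot_onto (x : Q) : exists a, x = quot_pi a.
Proof. by exists (quot_repr x); rewrite quot_reprK. Qed.

Lemma quot_piE (x y : A) : quot_pi x = quot_pi y <-> x - y \in I.
Proof.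
rewrite (Quotient.idealrBE I).
by split => [/eqP|/eqP].
Qed.

Lemma quot_piD : {morph quot_pi : x y / x + y}.
Proof. exact: (Quotient.pi_add I). Qed.

Lemma quot_piN : {morph quot_pi : x / - x}.
Proof. exact: (Quotient.pi_opp I). Qed.

Lemma quot_pi0 (x : A) : quot_pi x = 0 <-> x \in I.
Proof.
have <- : quot_pi 0 = 0 by apply: (addrI (quot_pi 0)); rewrite -quot_piD !addr0.
by rewrite quot_piE subr0.
Qed.

Definition quot_one : Q := quot_pi 1.
Definition quot_mul (x y : Q) : Q := quot_pi (quot_repr x * quot_repr y).

Lemma quot_mulE (x y : A) : quot_mul (quot_pi x) (quot_pi y) = quot_pi (x * y).
Proof.
apply/quot_piE; set x' := quot_repr _; set y' := quot_repr _.
have xI : x' - x \in I by apply/quot_piE; rewrite quot_reprK.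
have yI : y' - y \in I by apply/quot_piE; rewrite quot_reprK.
rewrite (_ : _ - _ = x' * (y' - y) + (x' - x) * y); last first.
  by rewrite mulrBr mulrBl addrA subrK.
by apply: rpredD; [apply: idealMl | apply: idealMr].
Qed.

Fact quot_mulA : associative quot_mul.
Proof.
move=> x y z; have [a ->] := quot_onto x; have [b ->] := quot_onto y.
by have [c ->] := quot_onto z; rewrite !quot_mulE mulrA.
Qed.
Fact quot_mulC : commutative quot_mul.
Proof.
move=> x y; have [a ->] := quot_onto x; have [b ->] := quot_onto y.
by rewrite !quot_mulE mulrC.
Qed.
Fact quot_mul1 : left_id quot_one quot_mul.
Proof. by move=> x; have [a ->] := quot_onto x; rewrite quot_mulE mul1r. Qed.
Fact quot_mulD : left_distributive quot_mul +%R.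
Proof.
move=> x y z; have [a ->] := quot_onto x; have [b ->] := quot_onto y.
by have [c ->] := quot_onto z; rewrite -quot_piD !quot_mulE -quot_piD mulrDl.
Qed.

HB.instance Definition _ := GRing.Zmodule_isComPzRing.Build Q
  quot_mulA quot_mulC quot_mul1 quot_mulD.

End QuotRing.

(* An element is a finitely supported family c with
   c n \in I^n / I^(n+1) inside A / I^(n+1).                                  *)
Definition gr_component (A : comNzRingType) (I : ideal A) (n : nat) :=
  quot_ring (ideal_pow I n.+1).

Record gr (A : comNzRingType) (I : ideal A) := Gr {
  gr_coef :> forall n, gr_component I n;
  gr_coefP : forall n, exists2 x,
    x \in ideal_pow I n & gr_coef n = quot_pi (ideal_pow I n.+1) x;
  gr_finite : exists N, forall n, (N <= n)%N -> gr_coef n = 0 }.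

Section GradedRing.
Variables (A : comNzRingType) (I : ideal A).
Local Notation G := (gr I).
Local Notation "I ^^ n" := (ideal_pow I n) (at level 29).
Local Notation gr_pi n x := (quot_pi (ideal_pow I n.+1) x : gr_component I n).

HB.instance Definition _ := gen_eqMixin G.
HB.instance Definition _ := gen_choiceMixin G.

Lemma gr_eq (c d : G) : (forall n, c n = d n) -> c = d.
Proof.
case: c d => [c cP cf] [d dP df] /= cd.
have E : c = d by apply: functional_extensionality_dep.
by case: _ / E in dP df *; congr Gr; apply: Prop_irrelevance.
Qed.

Lemma gr_repr (c : G) n : quot_repr (c n) \in I ^^ n.
Proof.
have [x xI cE] := gr_coefP c n.
rewrite -[quot_repr _](subrK x) rpredD //.
by apply/ideal_powS/quot_piE; rewrite quot_reprK.
Qed.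

(* The ring axioms of G(I) are inherited from {poly A} through the surjection
   from the Rees ring; this is why A is nonzero here.                         *)
Definition rees_poly (p : {poly A}) := forall n, p`_n \in I ^^ n.

Fact gr_of_polyP p : rees_poly p ->
  forall n, exists2 x, x \in I ^^ n & gr_pi n p`_n = gr_pi n x.
Proof. by move=> pR n; exists p`_n. Qed.
Fact gr_of_poly_finite (p : {poly A}) :
  exists N, forall n, (N <= n)%N -> gr_pi n p`_n = 0.
Proof.
by exists (size p) => n np; rewrite nth_default //; apply/quot_pi0/rpred0.
Qed.
Definition gr_of_poly p (pR : rees_poly p) : G :=
  Gr (gr_of_polyP pR) (gr_of_poly_finite p).

Lemma gr_lift (c : G) : exists p, exists pR : rees_poly p, c = gr_of_poly pR.
Proof.
have [N cN] := gr_finite c.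
have pE n : (\poly_(i < N) quot_repr (c i))`_n \in I ^^ n.
  by rewrite coef_poly; case: ifP => _; rewrite ?gr_repr ?rpred0.
exists (\poly_(i < N) quot_repr (c i)), pE; apply: gr_eq => n /=.
rewrite coef_poly; case: ltnP => [|/cN ->]; first by rewrite quot_reprK.
by symmetry; apply/quot_pi0/rpred0.
Qed.

Lemma rees_poly0 : rees_poly 0.
Proof. by move=> n; rewrite coef0 rpred0. Qed.
Lemma rees_poly1 : rees_poly 1.
Proof. by case=> [|n]; rewrite coef1 ?rpred0. Qed.
Lemma rees_polyN p : rees_poly p -> rees_poly (- p).
Proof. by move=> pR n; rewrite coefN rpredN. Qed.
Lemma rees_polyD p q : rees_poly p -> rees_poly q -> rees_poly (p + q).
Proof. by move=> pR qR n; rewrite coefD rpredD. Qed.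
Lemma rees_polyM p q : rees_poly p -> rees_poly q -> rees_poly (p * q).
Proof.
move=> pR qR n; rewrite coefM rpred_sum // => i _.
by have := ideal_powM (pR i) (qR (n - i)%N); rewrite subnKC // -ltnS.
Qed.

Definition gr_add_coef (c d : G) n : gr_component I n := c n + d n.
Definition gr_opp_coef (c : G) n : gr_component I n := - c n.
(* The product is computed on representatives; gr_mul_coefE shows that any
   others would do.                                                           *)
Definition gr_mul_coef (c d : G) n : gr_component I n :=
  gr_pi n (\sum_(i < n.+1) quot_repr (c i) * quot_repr (d (n - i)%N)).

Lemma gr_add_coefE p q (pR : rees_poly p) (qR : rees_poly q) n :
  gr_add_coef (gr_of_poly pR) (gr_of_poly qR) n = gr_pi n (p + q)`_n.
Proof. by rewrite coefD [RHS]quot_piD. Qed.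
Lemma gr_opp_coefE p (pR : rees_poly p) n :
  gr_opp_coef (gr_of_poly pR) n = gr_pi n (- p)`_n.
Proof. by rewrite coefN [RHS]quot_piN. Qed.
Lemma gr_mul_coefE p q (pR : rees_poly p) (qR : rees_poly q) n :
  gr_mul_coef (gr_of_poly pR) (gr_of_poly qR) n = gr_pi n (p * q)`_n.
Proof.
apply/quot_piE; rewrite coefM -sumrB rpred_sum // => i _.
set c := gr_of_poly pR; set d := gr_of_poly qR.
have /quot_piE cI : gr_pi i (quot_repr (c i)) = gr_pi i p`_i by rewrite quot_reprK.
have /quot_piE dI : gr_pi (n - i) (quot_repr (d (n - i)%N)) = gr_pi (n - i) q`_(n - i).
  by rewrite quot_reprK.
have in_n : (i + (n - i))%N = n by rewrite subnKC // -ltnS.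
rewrite (_ : _ - _ = quot_repr (c i) * (quot_repr (d (n - i)%N) - q`_(n - i))
                     + (quot_repr (c i) - p`_i) * q`_(n - i)); last first.
  by rewrite mulrBr mulrBl addrA subrK.
rewrite rpredD //.
  by have := ideal_powM (gr_repr c i) dI; rewrite addnS in_n.
by have := ideal_powM cI (qR (n - i)%N); rewrite addSn in_n.
Qed.

Fact gr_zeroP n : exists2 x, x \in I ^^ n & (0 : gr_component I n) = gr_pi n x.
Proof. by exists 0; [apply: rpred0 | apply/esym/quot_pi0/rpred0]. Qed.
Definition gr_zero : G := Gr gr_zeroP (ex_intro _ 0%N (fun _ _ => erefl)).

Definition gr_one : G := gr_of_poly rees_poly1.

Fact gr_addP c d n : exists2 x, x \in I ^^ n & gr_add_coef c d n = gr_pi n x.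
Proof.
have [[p [pR ->]] [q [qR ->]]] := (gr_lift c, gr_lift d).
by exists (p + q)`_n; [apply: rees_polyD | rewrite gr_add_coefE].
Qed.
Fact gr_add_finite c d : exists N, forall n, (N <= n)%N -> gr_add_coef c d n = 0.
Proof.
have [[p [pR ->]] [q [qR ->]]] := (gr_lift c, gr_lift d).
have [N Nz] := gr_of_poly_finite (p + q).
by exists N => n /Nz; rewrite gr_add_coefE.
Qed.
Definition gr_add c d : G := Gr (gr_addP c d) (gr_add_finite c d).

Fact gr_oppP c n : exists2 x, x \in I ^^ n & gr_opp_coef c n = gr_pi n x.
Proof.
have [p [pR ->]] := gr_lift c.
by exists (- p)`_n; [apply: rees_polyN | rewrite gr_opp_coefE].
Qed.
Fact gr_opp_finite c : exists N, forall n, (N <= n)%N -> gr_opp_coef c n = 0.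
Proof.
have [p [pR ->]] := gr_lift c; have [N Nz] := gr_of_poly_finite (- p).
by exists N => n /Nz; rewrite gr_opp_coefE.
Qed.
Definition gr_opp c : G := Gr (gr_oppP c) (gr_opp_finite c).

Fact gr_mulP c d n : exists2 x, x \in I ^^ n & gr_mul_coef c d n = gr_pi n x.
Proof.
have [[p [pR ->]] [q [qR ->]]] := (gr_lift c, gr_lift d).
by exists (p * q)`_n; [apply: rees_polyM | rewrite gr_mul_coefE].
Qed.
Fact gr_mul_finite c d : exists N, forall n, (N <= n)%N -> gr_mul_coef c d n = 0.
Proof.
have [[p [pR ->]] [q [qR ->]]] := (gr_lift c, gr_lift d).
have [N Nz] := gr_of_poly_finite (p * q).
by exists N => n /Nz; rewrite gr_mul_coefE.
Qed.
Definition gr_mul c d : G := Gr (gr_mulP c d) (gr_mul_finite c d).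

Lemma gr_of_poly_eq p q (pR : rees_poly p) (qR : rees_poly q) :
  p = q -> gr_of_poly pR = gr_of_poly qR.
Proof. by move=> E; apply: gr_eq => n /=; rewrite E. Qed.
Lemma gr_zeroE : gr_zero = gr_of_poly rees_poly0.
Proof. by apply: gr_eq => n /=; rewrite coef0; apply/esym/quot_pi0/rpred0. Qed.
Lemma gr_addE p q (pR : rees_poly p) (qR : rees_poly q) :
  gr_add (gr_of_poly pR) (gr_of_poly qR) = gr_of_poly (rees_polyD pR qR).
Proof. by apply: gr_eq => n; apply: gr_add_coefE. Qed.
Lemma gr_oppE p (pR : rees_poly p) :
  gr_opp (gr_of_poly pR) = gr_of_poly (rees_polyN pR).
Proof. by apply: gr_eq => n; apply: gr_opp_coefE. Qed.
Lemma gr_mulE p q (pR : rees_poly p) (qR : rees_poly q) :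
  gr_mul (gr_of_poly pR) (gr_of_poly qR) = gr_of_poly (rees_polyM pR qR).
Proof. by apply: gr_eq => n; apply: gr_mul_coefE. Qed.

Let lift3 (Q : G -> G -> G -> Prop) :
  (forall p q r (pR : rees_poly p) (qR : rees_poly q) (rR : rees_poly r),
     Q (gr_of_poly pR) (gr_of_poly qR) (gr_of_poly rR)) -> forall c d e, Q c d e.
Proof.
move=> QP c d e.
by have [[p [? ->]] [q [? ->]] [r [? ->]]] := And3 (gr_lift c) (gr_lift d) (gr_lift e).
Qed.

Fact gr_addA : associative gr_add.
Proof. by apply: lift3 => *; rewrite !gr_addE; apply/gr_of_poly_eq/addrA. Qed.
Fact gr_addC : commutative gr_add.
Proof.
move=> c d; have [[p [pR ->]] [q [qR ->]]] := (gr_lift c, gr_lift d).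
by rewrite !gr_addE; apply/gr_of_poly_eq/addrC.
Qed.
Fact gr_add0 : left_id gr_zero gr_add.
Proof.
move=> c; have [p [pR ->]] := gr_lift c.
by rewrite gr_zeroE gr_addE; apply/gr_of_poly_eq/add0r.
Qed.
Fact gr_addN : left_inverse gr_zero gr_opp gr_add.
Proof.
move=> c; have [p [pR ->]] := gr_lift c.
by rewrite gr_oppE gr_zeroE gr_addE; apply/gr_of_poly_eq/addNr.
Qed.
HB.instance Definition _ := GRing.isZmodule.Build G
  gr_addA gr_addC gr_add0 gr_addN.

Fact gr_mulA : associative gr_mul.
Proof. by apply: lift3 => *; rewrite !gr_mulE; apply/gr_of_poly_eq/mulrA. Qed.
Fact gr_mulC : commutative gr_mul.
Proof.
move=> c d; have [[p [pR ->]] [q [qR ->]]] := (gr_lift c, gr_lift d).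
by rewrite !gr_mulE; apply/gr_of_poly_eq/mulrC.
Qed.
Fact gr_mul1 : left_id gr_one gr_mul.
Proof.
move=> c; have [p [pR ->]] := gr_lift c.
by rewrite gr_mulE; apply/gr_of_poly_eq/mul1r.
Qed.
Fact gr_mulD : left_distributive gr_mul +%R.
Proof.
apply: lift3 => p q r pR qR rR.
rewrite -[gr_of_poly pR + _]/(gr_add _ _) -[RHS]/(gr_add _ _).
by rewrite !gr_addE !gr_mulE gr_addE; apply/gr_of_poly_eq/mulrDl.
Qed.
HB.instance Definition _ := GRing.Zmodule_isComPzRing.Build G
  gr_mulA gr_mulC gr_mul1 gr_mulD.

End GradedRing.

Definition noetherian (A : comPzRingType) : Prop :=
  forall I : ideal A, exists s : seq A, forall x,
    x \in I <-> exists c : nat -> A, x = \sum_(i < size s) c i * s`_i.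

Definition maximal_ideal (A : comPzRingType) (m : ideal A) : Prop :=
  1 \notin m /\
  forall J : ideal A, 1 \notin J -> {subset m <= J} -> {subset J <= m}.

Definition local_ring (A : comPzRingType) (m : ideal A) : Prop :=
  maximal_ideal m /\ forall m' : ideal A, maximal_ideal m' -> m' =i m.

Definition finitely_generated_algebra (A B : comPzRingType)
    (f : {rmorphism A -> B}) : Prop :=
  exists s : seq B, forall S : {pred B}, subring_closed S ->
    (forall a, f a \in S) -> {subset s <= S} -> forall b, b \in S.

Definition is_localization (A B : comPzRingType) (S : {pred A})
    (f : {rmorphism A -> B}) : Prop :=
  [/\ forall s, s \in S -> exists u, f s * u = 1,
      forall b, exists a, exists2 s, s \in S & b * f s = f a &
      forall a a', f a = f a' <-> exists2 s, s \in S & s * a = s * a'].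

Section FaithfullyFlat.
Variables (B A : comPzRingType) (j : {rmorphism B -> A}).

(* B-bilinear maps out of M * A, where B acts on A through j.                 *)
Definition bilinear_along (M T : lmodType B) (t : M -> A -> T) : Prop :=
  [/\ forall x y a, t (x + y) a = t x a + t y a,
      forall x a a', t x (a + a') = t x a + t x a',
      forall b x a, t (b *: x) a = b *: t x a &
      forall b x a, t x (j b * a) = b *: t x a].

Definition is_tensor_product (M T : lmodType B) (t : M -> A -> T) : Prop :=
  bilinear_along t /\
  forall (U : lmodType B) (u : M -> A -> U), bilinear_along u ->
    exists h : {linear T -> U}, (forall x a, h (t x a) = u x a) /\
      forall h' : {linear T -> U}, (forall x a, h' (t x a) = u x a) -> h' =1 h.

Definition exact (M1 M2 M3 : lmodType B)
    (f : {linear M1 -> M2}) (g : {linear M2 -> M3}) : Prop :=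
  forall y, g y = 0 <-> exists x, f x = y.

Definition faithfully_flat : Prop :=
  forall (M1 M2 M3 T1 T2 T3 : lmodType B)
    (f : {linear M1 -> M2}) (g : {linear M2 -> M3})
    (t1 : M1 -> A -> T1) (t2 : M2 -> A -> T2) (t3 : M3 -> A -> T3)
    (fA : {linear T1 -> T2}) (gA : {linear T2 -> T3}),
  is_tensor_product t1 -> is_tensor_product t2 -> is_tensor_product t3 ->
  (forall x a, fA (t1 x a) = t2 (f x) a) ->
  (forall x a, gA (t2 x a) = t3 (g x) a) ->
  (exact f g <-> exact fA gA).

End FaithfullyFlat.

(* A subring of C is given as a ring B with an injective morphism B -> C; these
   predicates describe its image, which determines B up to isomorphism.       *)

Definition is_rees_ring (A : comNzRingType) (I : ideal A) (B : comPzRingType)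
    (j : {rmorphism B -> {poly A}}) : Prop :=
  injective j /\
  forall p : {poly A}, (exists b, j b = p) <-> forall n, p`_n \in ideal_pow I n.

(* A[t, t^-1] as the localization of A[t] at the powers of t.                 *)
Definition is_laurent_ring (A : comNzRingType) (L : comPzRingType)
    (l : {rmorphism {poly A} -> L}) : Prop :=
  is_localization (fun p => `[< exists k, p = 'X^k >]) l.

(* With u = t^-1, the elements of A[It, t^-1] are the sums of the a_n t^n with
   a_n \in I^n and of the b_n t^-n with b_n \in A.                            *)
Definition is_extended_rees_ring (A : comNzRingType) (I : ideal A)
    (L B : comPzRingType) (l : {rmorphism {poly A} -> L})
    (j : {rmorphism B -> L}) : Prop :=
  injective j /\
  forall u, l 'X * u = 1 -> forall x, (exists b, j b = x) <->
    exists a b : {poly A}, (forall n, a`_n \in ideal_pow I n) /\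
      x = l a + \sum_(n < size b) l (b`_n)%:P * u ^+ n.

(* D is given by its class of objects: no hypothesis concerns its morphisms.
   In the Rees closure conditions A is nonzero, as {poly A} requires; for A = 0
   both Rees rings are the zero ring A itself.                                *)
Record closed_noetherian_class (D : comPzRingType -> Prop) : Prop := {
  class_noetherian : forall A, D A -> noetherian A;
  class_algebra : forall (A B : comPzRingType) (f : {rmorphism A -> B}),
    D A -> finitely_generated_algebra f -> D B;
  class_localization : forall (A B : comPzRingType) (S : {pred A})
    (f : {rmorphism A -> B}),
    D A -> mulr_closed S -> is_localization S f -> D B;
  class_faithfully_flat : forall (A B : comPzRingType) (j : {rmorphism B -> A}),
    D A -> injective j -> faithfully_flat j -> D B;
  class_rees : forall (A : comNzRingType) (I : ideal A) (B : comPzRingType)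
    (j : {rmorphism B -> {poly A}}), D A -> is_rees_ring I j -> D B;
  class_extended_rees : forall (A : comNzRingType) (I : ideal A)
    (L B : comPzRingType) (l : {rmorphism {poly A} -> L})
    (j : {rmorphism B -> L}),
    D A -> is_laurent_ring l -> is_extended_rees_ring I l j -> D B }.

Definition ring_theoretic_property (D P : comPzRingType -> Prop) : Prop :=
  forall (A B : comPzRingType) (f : {rmorphism A -> B}),
    D A -> D B -> bijective f -> P A -> P B.

(* Main.v *)
Require Import Defs.
From HB Require Import structures.
From mathcomp Require Import all_boot all_order all_algebra.
From mathcomp Require Import boolp.
Set Implicit Arguments.
Unset Strict Implicit.
Unset Printing Implicit Defensive.
Import GRing.Theory.
Local Open Scope ring_scope.

(** As y is a nonzero divisor, multiplication by y^n identifies A/yA with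
    y^n A / y^(n+1) A, so that G(yA) is isomorphic to (A/yA)[X]; moreover A/yA
    is nonzero since y lies in the maximal ideal.  Hence (a) carries P from A/yA
    to G(yA), and (b) carries it from G(yA) to A. *)

Lemma mem_principal_pow (A : comPzRingType) (y : A) n x :
  x \in ideal_pow (principal y) n <-> exists a, x = a * y ^+ n.
Proof.
split=> [|[a ->]]; last first.
  apply: idealMl; elim: n => [//|n IHn]; rewrite exprS.
  (* The first power is by definition the product of the ideal with the whole ring, so [y] enters it
     as the one-term sum [y * 1]. *)
  apply: (@ideal_powM _ (principal y) 1 n) => //; apply/asboolP.
  exists [:: (y, 1)] => [p|]; last by rewrite big_seq1 mulr1.
  rewrite inE => /eqP -> /=; rewrite andbT.
  by apply/asboolP; exists 1; rewrite mul1r.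
elim: n x => [x _|n IHn x]; first by exists x; rewrite mulr1.
elim/ideal_powSP => [_ b /asboolP[c ->] /IHn[d ->]||_ _ [c ->] [d ->]].
- by exists (c * d); rewrite exprS mulrACA.
- by exists 0; rewrite mul0r.
- by exists (c + d); rewrite mulrDl.
Qed.

Section QuotientMap.
Variables (A : comPzRingType) (I : ideal A).

Lemma quot_pi_is_zmod_morphism : zmod_morphism (quot_pi I).
Proof. by move=> a b; rewrite quot_piD quot_piN. Qed.

Lemma quot_pi_is_monoid_morphism : monoid_morphism (quot_pi I).
Proof. by split=> // a b; rewrite -[LHS]quot_mulE. Qed.

HB.instance Definition _ := GRing.isZmodMorphism.Build A (quot_ring I)
  (quot_pi I) quot_pi_is_zmod_morphism.
HB.instance Definition _ := GRing.isMonoidMorphism.Build A (quot_ring I)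
  (quot_pi I) quot_pi_is_monoid_morphism.

End QuotientMap.

(** An alias of [quot_ring] that carries the properness proof as a parameter, so that a nonzero ring
    structure can be attached to it; [{poly _}] requires one. *)
Definition proper_quot (A : comPzRingType) (I : ideal A) (I_proper : 1 \notin I) :=
  quot_ring I.

Section ProperQuotient.
Variables (A : comPzRingType) (I : ideal A) (I_proper : 1 \notin I).
Local Notation Q := (proper_quot I_proper).

HB.instance Definition _ := GRing.ComPzRing.on Q.

Lemma quot_oner_neq0 : (1 : Q) != 0.
Proof. by apply: contraNneq I_proper => /quot_pi0. Qed.

HB.instance Definition _ := GRing.PzSemiRing_isNonZero.Build Q quot_oner_neq0.

End ProperQuotient.

(** Equal kernels give equal fibres, so [g] factors through [f]: lift along a chosen section of [f],
    then apply [g]. The inverse arises in the same way with the roles exchanged. *)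
Lemma iso_of_eq_ker (R S T : pzRingType)
    (f : {rmorphism R -> S}) (g : {rmorphism R -> T}) :
  (forall x, exists r, x = f r) -> (forall z, exists r, z = g r) ->
  (forall r, f r = 0 <-> g r = 0) ->
  exists h : {rmorphism S -> T}, bijective h.
Proof.
move=> /choice[s sK] /choice[t tK] eq_ker.
have eq_fibres r r' : f r = f r' <-> g r = g r'.
  by split=> /eqP; rewrite -subr_eq0 -rmorphB => /eqP/eq_ker/eqP;
     rewrite rmorphB subr_eq0 => /eqP.
(* The section [s] need not be a morphism, but [g \o s] does not depend on its choices and is
   one. *)
have gsE r : g (s (f r)) = g r by apply/eq_fibres; rewrite -sK.
have hB : zmod_morphism (g \o s).
  by move=> x y; rewrite /= [in LHS](sK x) [in LHS](sK y) -rmorphB gsE rmorphB.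
have hM : monoid_morphism (g \o s).
  split=> [|x y] /=; first by rewrite -(rmorph1 f) gsE rmorph1.
  by rewrite [in LHS](sK x) [in LHS](sK y) -rmorphM gsE rmorphM.
pose h : {rmorphism S -> T} := HB.pack (g \o s)
  (GRing.isZmodMorphism.Build S T _ hB) (GRing.isMonoidMorphism.Build S T _ hM).
exists h, (f \o t) => [x|z] /=; last by rewrite gsE -tK.
by rewrite [RHS]sK; apply/eq_fibres; rewrite -tK.
Qed.

Section FinitelyGeneratedAlgebras.
Variables (D : comPzRingType -> Prop) (D_closed : closed_noetherian_class D).

(** Such a [B] is generated as an [A]-algebra by the empty family. *)
Lemma class_surjective (A B : comPzRingType) (f : {rmorphism A -> B}) :
  (forall b, exists a, b = f a) -> D A -> D B.
Proof.
move=> f_onto DA; apply: (class_algebra D_closed (f := f)) => //.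
by exists [::] => S _ fS _ b; have [a ->] := f_onto b.
Qed.

Lemma class_poly (A : comNzRingType) : D A -> D {poly A}.
Proof.
move=> DA; apply: (class_algebra D_closed (f := @polyC A)) => //.
exists [:: 'X] => S [S1 SB SM] CS XS.
have S0 : 0 \in S by rewrite -(subrr 1) SB.
have SD p q : p \in S -> q \in S -> p + q \in S.
  by move=> pS qS; rewrite -[q]opprK SB // -sub0r SB.
elim/poly_ind=> // p c pS.
by apply: SD; [apply: SM => //; apply: XS; rewrite mem_head | apply: CS].
Qed.

End FinitelyGeneratedAlgebras.

Section GradedPrincipal.
Variables (A : comNzRingType) (y : A).
Local Notation I := (principal y).

Lemma coef_scaleX (p : {poly A}) n : (p \Po (y *: 'X))`_n = p`_n * y ^+ n.
Proof.
elim/poly_ind: p n => [|p c IHp] n; first by rewrite comp_poly0 !coef0 mul0r.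
rewrite comp_poly_MXaddC -scalerAr !coefD !coefC coefZ !coefMX.
by case: n => [|n] /=; rewrite ?mulr0 ?add0r ?mulr1 // !addr0 IHp mulrCA exprS.
Qed.

Lemma rees_scaleX (p : {poly A}) : rees_poly I (p \Po (y *: 'X)).
Proof. by move=> n; apply/mem_principal_pow; exists p`_n; apply: coef_scaleX. Qed.

(** The [A]-algebra morphism from $A[X]$ to $G(yA)$ sending $X$ to the class of $y$ in degree 1,
    factored through the Rees ring as $p(X) \mapsto p(yX)$. *)
Definition poly_to_gr (p : {poly A}) : gr I := gr_of_poly (rees_scaleX p).

Lemma poly_to_gr_is_zmod_morphism : zmod_morphism poly_to_gr.
Proof.
move=> p q; rewrite -[RHS]/(gr_add _ (gr_opp _)) gr_oppE gr_addE.
exact/gr_of_poly_eq/rmorphB.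
Qed.

Lemma poly_to_gr_is_monoid_morphism : monoid_morphism poly_to_gr.
Proof.
split=> [|p q]; first exact/gr_of_poly_eq/rmorph1.
by rewrite -[RHS]/(gr_mul _ _) gr_mulE; apply/gr_of_poly_eq/rmorphM.
Qed.

HB.instance Definition _ := GRing.isZmodMorphism.Build {poly A} (gr I)
  poly_to_gr poly_to_gr_is_zmod_morphism.
HB.instance Definition _ := GRing.isMonoidMorphism.Build {poly A} (gr I)
  poly_to_gr poly_to_gr_is_monoid_morphism.

Lemma poly_to_gr_onto (c : gr I) : exists p, c = poly_to_gr p.
Proof.
have [p [pR ->]] := gr_lift c.
have /choice[a aE] n : exists a, p`_n = a * y ^+ n by apply/mem_principal_pow.
(* Beyond [size p] the chosen [a n] are arbitrary, hence the truncation. *)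
exists (\poly_(n < size p) a n); apply/gr_of_poly_eq/polyP => n.
rewrite coef_scaleX coef_poly; case: ltnP => [//|/(nth_default 0) ->].
by rewrite mul0r.
Qed.

(** In degree $n$, $p_n y^n \in y^{n+1}A$ amounts to $p_n \in yA$: regularity of [y] allows
    cancelling $y^n$. *)
Lemma poly_to_gr_eq0 (p : {poly A}) : GRing.lreg y ->
  poly_to_gr p = 0 <-> forall n, p`_n \in I.
Proof.
move=> y_reg.
have coef_eq0 n : poly_to_gr p n = 0 <-> p`_n \in I.
  rewrite [poly_to_gr p n]/(quot_pi _ _) quot_pi0 mem_principal_pow coef_scaleX.
  split=> [[a]|/asboolP[a ->]]; last by exists a; rewrite -mulrA -exprS.
  rewrite exprS mulrA ![_ * y ^+ n]mulrC => /(lregX y_reg) ->.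
  by apply/asboolP; exists a.
split=> [p0 n|pI]; first by apply/coef_eq0; rewrite p0.
by apply: gr_eq => n; apply/coef_eq0.
Qed.

(** Reduction of coefficients modulo [y] and [poly_to_gr] are surjections from $A[X]$ with the same
    kernel, the polynomials with all coefficients in $yA$. *)
Lemma poly_quot_gr_iso (yA_proper : 1 \notin I) : GRing.lreg y ->
  exists h : {rmorphism {poly proper_quot yA_proper} -> gr I}, bijective h.
Proof.
move=> y_reg; pose pi : {rmorphism A -> proper_quot yA_proper} := quot_pi I.
have pi_onto (q : {poly proper_quot yA_proper}) : exists p, q = map_poly pi p.
  exists (\poly_(n < size q) quot_repr q`_n); apply/polyP => n.
  rewrite coef_map coef_poly; case: ltnP => [_|/(nth_default 0) ->].
    exact/esym/quot_reprK.
  exact/esym/quot_pi0/rpred0.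
apply: (iso_of_eq_ker pi_onto poly_to_gr_onto) => p.
rewrite poly_to_gr_eq0 //; split=> [/polyP p0 n|pI].
  by apply/quot_pi0; have := p0 n; rewrite coef_map coef0.
by apply/polyP => n; rewrite coef_map coef0; apply/quot_pi0.
Qed.

End GradedPrincipal.

Theorem proposition3p1 (D P : comPzRingType -> Prop)
  (D_closed : closed_noetherian_class D)
  (P_iso : ring_theoretic_property D P)
  (P_poly : forall A : comNzRingType, D A -> P A -> P {poly A})
  (P_graded : forall (A : comNzRingType) (m : ideal A) (y : A),
    D A -> local_ring m -> y \in m -> GRing.lreg y ->
    P (gr (principal y)) -> P A) :
  forall (A : comNzRingType) (m : ideal A) (y : A),
    D A -> local_ring m -> y \in m -> GRing.lreg y ->
    P (quot_ring (principal y)) -> P A.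
Proof.
move=> A m y DA m_local ym y_reg PQ.
have [[m_proper _] _] := m_local.
have yA_proper : 1 \notin principal y.
  by apply: contra m_proper => /asboolP[a ->]; apply: idealMl.
(* [P_iso] transports [P] only between members of [D], so $(A/yA)[X]$ and $G(yA)$ are both placed in
   [D], the latter as the image of [h]. *)
have DQ : D (proper_quot yA_proper).
  by apply: (class_surjective D_closed (f := quot_pi _)) DA; apply: quot_onto.
have DQX := class_poly D_closed DQ.
have [h h_bij] := poly_quot_gr_iso yA_proper y_reg.
have DG : D (gr (principal y)).
  apply: (class_surjective D_closed (f := h)) DQX => c.
  by have [k _ hK] := h_bij; exists (k c).
by apply: P_graded m_local ym y_reg _ => //; apply: P_iso h_bij _ => //; apply: P_poly.
Qed.
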